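(* Let $n\ge 1$ be an integer. The electrical Lie algebra $\mathfrak{e}_{A_{2n+1}}$ is an extension of $\mathfrak{sp}_{2n}\ltimes V_\nu$ by the trivial representation $V_{\mathbf 0}$; that is, there is a short exact sequence of Lie algebras \[0\longrightarrow \mathbb{C}\longrightarrow \mathfrak{e}_{A_{2n+1}}\longrightarrow \mathfrak{sp}_{2n}\ltimes \mathbb{C}^{2n}\longrightarrow 0,\] where the image of $\mathbb{C}$ is a one-dimensional central ideal (on which $\mathfrak{sp}_{2n}$ acts trivially), and $\mathfrak{sp}_{2n}\ltimes\mathbb{C}^{2n}$ is the semidirect product of $\mathfrak{sp}_{2n}$ with the abelian Lie algebra $\mathbb{C}^{2n}=V_\nu$ carrying the standard representation of $\mathfrak{sp}_{2n}$.
   Context: All Lie algebras are over $\mathbb{C}$. For $m\ge 1$, $\mathfrak{e}_{A_m}$ is the Lie algebra generated by $e_1,\dots,e_m$ subject to $[e_i,e_j]=0$ if $|i-j|\ge 2$ and $[e_i,[e_i,e_j]]=-2e_i$ if $|i-j|=1$. $\mathfrak{sp}_{2n}$ is the symplectic Lie algebra of $2n\times 2n$ matrices; $V_\nu$ denotes its standard representation (highest weight $\nu=\omega_1$, the first fundamental weight) and $V_{\mathbf 0}$ its trivial one-dimensional representation. *)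

(* Defs.v *)
From HB Require Import structures.
From mathcomp Require Import all_boot all_order all_algebra.
From mathcomp Require Import ssrAC boolp reals complex.

Set Implicit Arguments.
Unset Strict Implicit.
Unset Printing Implicit Defensive.

Import GRing.Theory.
Local Open Scope ring_scope.
Local Open Scope quotient_scope.

HB.mixin Record Lmodule_isLie (K : fieldType) L of GRing.Lmodule K L := {
  bracket : L -> L -> L;
  bracket_linearl : forall y, linear (fun x => bracket x y);
  bracket_linearr : forall x, linear (bracket x);
  bracketxx : forall x, bracket x x = 0;
  bracket_jacobi : forall x y z,
    bracket x (bracket y z) + bracket y (bracket z x)
      + bracket z (bracket x y) = 0
}.

#[short(type="lieAlgType")]
HB.structure Definition LieAlgebra (K : fieldType) :=
  { L of GRing.Lmodule K L & Lmodule_isLie K L }.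

Definition lie_morphism (K : fieldType) (L M : lieAlgType K)
    (f : {linear L -> M}) : Prop :=
  forall x y, f (bracket x y) = bracket (f x) (f y).

Definition short_exact (K : fieldType) (A L M : lieAlgType K)
    (i : {linear A -> L}) (p : {linear L -> M}) : Prop :=
  [/\ injective i,
      forall x, p x = 0 <-> exists a, x = i a
    & forall y, exists x, p x = y].

(* Centrality of the kernel of an extension says that the induced action on
   it is trivial. *)
Definition central (K : fieldType) (L : lieAlgType K) (z : L) : Prop :=
  forall x, bracket x z = 0.

Definition abelian_lie (K : fieldType) (V : lmodType K) : Type := V.

Section Abelian.
Variables (K : fieldType) (V : lmodType K).

HB.instance Definition _ := GRing.Lmodule.on (abelian_lie V).

Let br (_ _ : abelian_lie V) : abelian_lie V := 0.

Fact abelian_linearl y : linear (fun x => br x y).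
Proof. by move=> a u v; rewrite /br scaler0 addr0. Qed.

Fact abelian_linearr x : linear (br x).
Proof. by move=> a u v; rewrite /br scaler0 addr0. Qed.

Fact abelian_xx x : br x x = 0.
Proof. by []. Qed.

Fact abelian_jacobi x y z : br x (br y z) + br y (br z x) + br z (br x y) = 0.
Proof. by rewrite /br !addr0. Qed.

HB.instance Definition _ := Lmodule_isLie.Build K (abelian_lie V)
  abelian_linearl abelian_linearr abelian_xx abelian_jacobi.

End Abelian.

Record lie_rep (K : fieldType) (g : lieAlgType K) (V : lmodType K) := LieRep {
  lie_act :> g -> V -> V;
  lie_act_linearl : forall v, linear (lie_act^~ v);
  lie_act_linearr : forall x, linear (lie_act x);
  lie_act_bracket : forall x y v,
    lie_act (bracket x y) v = lie_act x (lie_act y v) - lie_act y (lie_act x v)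
}.

Definition semidirect (K : fieldType) (g : lieAlgType K) (V : lmodType K)
  (rho : lie_rep g V) : Type := (g * V)%type.

Section Semidirect.
Variables (K : fieldType) (g : lieAlgType K) (V : lmodType K).
Variable rho : lie_rep g V.

HB.instance Definition _ := GRing.Lmodule.copy (semidirect rho) (g * V)%type.

Definition semidirect_bracket (x y : semidirect rho) : semidirect rho :=
  (bracket x.1 y.1, rho x.1 y.2 - rho y.1 x.2).

Fact semidirect_linearl y : linear (fun x => semidirect_bracket x y).
Proof.
move=> a [u1 u2] [v1 v2]; rewrite /semidirect_bracket /=; congr pair.
  exact: bracket_linearl.
have /= -> := lie_act_linearl rho y.2 a u1 v1.
by rewrite (lie_act_linearr rho) /= scalerBr opprD addrACA.
Qed.

Fact semidirect_linearr x : linear (semidirect_bracket x).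
Proof.
move=> a [u1 u2] [v1 v2]; rewrite /semidirect_bracket /=; congr pair.
  exact: bracket_linearr.
have /= -> := lie_act_linearl rho x.2 a u1 v1.
by rewrite (lie_act_linearr rho) /= scalerBr opprD addrACA.
Qed.

Fact semidirect_xx x : semidirect_bracket x x = 0.
Proof. by rewrite /semidirect_bracket bracketxx subrr. Qed.

Fact semidirect_jacobi x y z :
  semidirect_bracket x (semidirect_bracket y z)
    + semidirect_bracket y (semidirect_bracket z x)
    + semidirect_bracket z (semidirect_bracket x y) = 0.
Proof.
have actB u v w : rho u (v - w) = rho u v - rho u w.
  by rewrite addrC -scaleN1r (lie_act_linearr rho) scaleN1r addrC.
case: x y z => [x1 x2] [y1 y2] [z1 z2]; rewrite /semidirect_bracket /=.
congr pair; first exact: bracket_jacobi.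
rewrite /= !actB !(lie_act_bracket rho) !opprB.
rewrite (AC ((2*2)*(2*2)*(2*2)) ((1*12)*(2*7)*(3*10)*(4*5)*(6*11)*(8*9))).
by rewrite /= !subrr !addNr !addr0.
Qed.

HB.instance Definition _ := Lmodule_isLie.Build K (semidirect rho)
  semidirect_linearl semidirect_linearr semidirect_xx semidirect_jacobi.

End Semidirect.

Section Symplectic.
Variables (K : fieldType) (n : nat).

Definition sympl_form : 'M[K]_(n + n) := block_mx 0 1%:M (- 1%:M) 0.

Definition is_sp : {pred 'M[K]_(n + n)} :=
  [pred A : 'M[K]_(n + n) | A^T *m sympl_form + sympl_form *m A == 0].

Record sp := Sp { sp_mx :> 'M[K]_(n + n); sp_mxP : sp_mx \in is_sp }.

HB.instance Definition _ := [isSub for sp_mx].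
HB.instance Definition _ := [Choice of sp by <:].

Fact is_sp_submod : submod_closed is_sp.
Proof.
split=> [|a A B]; first by rewrite inE trmx0 mul0mx mulmx0 addr0.
rewrite !inE => /eqP hA /eqP hB; rewrite linearP /= mulmxDl mulmxDr.
by rewrite -scalemxAl -scalemxAr addrACA -scalerDr hA hB scaler0 addr0.
Qed.

HB.instance Definition _ := GRing.isSubmodClosed.Build K _ is_sp is_sp_submod.
HB.instance Definition _ := [SubChoice_isSubLmodule of sp by <:].

Fact is_sp_comm (A B : sp) : A *m B - B *m A \in is_sp.
Proof.
case: A B => [A /= +] [B /= +]; rewrite !inE => /eqP hA /eqP hB.
have tA : A^T *m sympl_form = - (sympl_form *m A) by apply/eqP; rewrite -addr_eq0 hA.
have tB : B^T *m sympl_form = - (sympl_form *m B) by apply/eqP; rewrite -addr_eq0 hB.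
rewrite linearB /= !trmx_mul mulmxBl mulmxBr -!mulmxA tA tB !mulmxN !mulmxA tA tB.
by rewrite !mulNmx !opprK addrA subrK subrr.
Qed.

Definition sp_bracket (A B : sp) : sp := Sp (is_sp_comm A B).

Fact sp_linearl B : linear (fun A => sp_bracket A B).
Proof.
move=> a A1 A2; apply/val_inj => /=.
rewrite mulmxDl mulmxDr -scalemxAl -scalemxAr scalerBr opprD addrACA.
by [].
Qed.

Fact sp_linearr A : linear (sp_bracket A).
Proof.
move=> a A1 A2; apply/val_inj => /=.
rewrite mulmxDl mulmxDr -scalemxAl -scalemxAr scalerBr opprD addrACA.
by [].
Qed.

Fact sp_xx A : sp_bracket A A = 0.
Proof. by apply/val_inj; rewrite /= subrr. Qed.

Fact sp_jacobi A B C :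
  sp_bracket A (sp_bracket B C) + sp_bracket B (sp_bracket C A)
    + sp_bracket C (sp_bracket A B) = 0.
Proof.
apply/val_inj => /=; rewrite !mulmxBl !mulmxBr !mulmxA !opprB.
rewrite (AC ((2*2)*(2*2)*(2*2)) ((1*12)*(2*7)*(3*10)*(4*5)*(6*11)*(8*9))).
by rewrite /= !subrr !addNr !addr0.
Qed.

HB.instance Definition _ :=
  Lmodule_isLie.Build K sp sp_linearl sp_linearr sp_xx sp_jacobi.

Definition std_act (A : sp) (v : 'cV[K]_(n + n)) : 'cV[K]_(n + n) := A *m v.

Fact std_act_linearl v : linear (std_act^~ v).
Proof. by move=> a A B; rewrite /std_act mulmxDl -scalemxAl. Qed.

Fact std_act_linearr A : linear (std_act A).
Proof. by move=> a u v; rewrite /std_act mulmxDr -scalemxAr. Qed.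

Fact std_act_bracket A B v :
  std_act (bracket A B) v = std_act A (std_act B v) - std_act B (std_act A v).
Proof. by rewrite /std_act mulmxBl !mulmxA. Qed.

Definition sp_std : lie_rep sp 'cV[K]_(n + n) :=
  LieRep std_act_linearl std_act_linearr std_act_bracket.

End Symplectic.

Inductive lie_term (K I : Type) :=
| LGen of I
| LZero
| LOpp of lie_term K I
| LAdd of lie_term K I & lie_term K I
| LScale of K & lie_term K I
| LBracket of lie_term K I & lie_term K I.

Arguments LGen {K I}.
Arguments LZero {K I}.

HB.instance Definition _ K I := gen_eqMixin (lie_term K I).
HB.instance Definition _ K I := gen_choiceMixin (lie_term K I).

Section Presentation.
Variables (K : fieldType) (I : Type).
Local Notation term := (lie_term K I).
Variable rels : term -> term -> Prop.

(* The least congruence containing [rels] whose quotient is a Lie algebra. *)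
Inductive lie_eqv : term -> term -> Prop :=
| EqvRel s t of rels s t : lie_eqv s t
| EqvRefl t : lie_eqv t t
| EqvSym s t of lie_eqv s t : lie_eqv t s
| EqvTrans s t u of lie_eqv s t & lie_eqv t u : lie_eqv s u
| EqvOpp s s' of lie_eqv s s' : lie_eqv (LOpp s) (LOpp s')
| EqvAdd s s' t t' of lie_eqv s s' & lie_eqv t t' :
    lie_eqv (LAdd s t) (LAdd s' t')
| EqvScale a s s' of lie_eqv s s' : lie_eqv (LScale a s) (LScale a s')
| EqvBracket s s' t t' of lie_eqv s s' & lie_eqv t t' :
    lie_eqv (LBracket s t) (LBracket s' t')
| EqvAddA s t u : lie_eqv (LAdd s (LAdd t u)) (LAdd (LAdd s t) u)
| EqvAddC s t : lie_eqv (LAdd s t) (LAdd t s)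
| EqvAdd0 t : lie_eqv (LAdd LZero t) t
| EqvAddN t : lie_eqv (LAdd (LOpp t) t) LZero
| EqvScaleA a b t : lie_eqv (LScale a (LScale b t)) (LScale (a * b) t)
| EqvScale1 t : lie_eqv (LScale 1 t) t
| EqvScaleDr a s t :
    lie_eqv (LScale a (LAdd s t)) (LAdd (LScale a s) (LScale a t))
| EqvScaleDl a b t :
    lie_eqv (LScale (a + b) t) (LAdd (LScale a t) (LScale b t))
| EqvBracketl a s t u :
    lie_eqv (LBracket (LAdd (LScale a s) t) u)
            (LAdd (LScale a (LBracket s u)) (LBracket t u))
| EqvBracketr a s t u :
    lie_eqv (LBracket u (LAdd (LScale a s) t))
            (LAdd (LScale a (LBracket u s)) (LBracket u t))
| EqvBracketxx t : lie_eqv (LBracket t t) LZero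
| EqvJacobi s t u :
    lie_eqv (LAdd (LAdd (LBracket s (LBracket t u)) (LBracket t (LBracket u s)))
                  (LBracket u (LBracket s t))) LZero.

Definition lie_eqvb : rel term := fun s t => `[< lie_eqv s t >].

Fact lie_eqvb_refl : reflexive lie_eqvb.
Proof. by move=> t; apply/asboolP/EqvRefl. Qed.

Fact lie_eqvb_sym : symmetric lie_eqvb.
Proof. by move=> s t; apply/asboolP/asboolP; apply: EqvSym. Qed.

Fact lie_eqvb_trans : transitive lie_eqvb.
Proof.
by move=> t s u /asboolP st /asboolP tu; apply/asboolP/(EqvTrans st tu).
Qed.

Definition lie_equiv := EquivRel _ lie_eqvb_refl lie_eqvb_sym lie_eqvb_trans.

Definition presented_lie : Type := {eq_quot lie_equiv}.

HB.instance Definition _ := Choice.on presented_lie.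
HB.instance Definition _ := Quotient.on presented_lie.

Definition lie_class (t : term) : presented_lie := \pi_presented_lie t.

Definition lie_gen (i : I) : presented_lie := lie_class (LGen i).

Fact lie_classP s t : lie_class s = lie_class t <-> lie_eqv s t.
Proof. by split=> [/eqmodP/asboolP | st]; last exact/eqmodP/asboolP. Qed.

Fact lie_classW (P : presented_lie -> Prop) :
  (forall t, P (lie_class t)) -> forall x, P x.
Proof. by move=> Pt x; rewrite -[x]reprK. Qed.

Definition pres_opp (x : presented_lie) := lie_class (LOpp (repr x)).
Definition pres_add (x y : presented_lie) :=
  lie_class (LAdd (repr x) (repr y)).
Definition pres_scale (a : K) (x : presented_lie) :=
  lie_class (LScale a (repr x)).
Definition pres_bracket (x y : presented_lie) :=
  lie_class (LBracket (repr x) (repr y)).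

Fact repr_class t : lie_eqv (repr (lie_class t)) t.
Proof. by apply/lie_classP; rewrite /lie_class reprK. Qed.

Fact pres_oppE t : pres_opp (lie_class t) = lie_class (LOpp t).
Proof. exact/lie_classP/EqvOpp/repr_class. Qed.

Fact pres_addE s t :
  pres_add (lie_class s) (lie_class t) = lie_class (LAdd s t).
Proof. by apply/lie_classP; apply: EqvAdd; apply: repr_class. Qed.

Fact pres_scaleE a t : pres_scale a (lie_class t) = lie_class (LScale a t).
Proof. exact/lie_classP/EqvScale/repr_class. Qed.

Fact pres_bracketE s t :
  pres_bracket (lie_class s) (lie_class t) = lie_class (LBracket s t).
Proof. by apply/lie_classP; apply: EqvBracket; apply: repr_class. Qed.

Let presE := (pres_oppE, pres_addE, pres_scaleE, pres_bracketE).

Fact pres_addA : associative pres_add.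
Proof.
elim/lie_classW=> s; elim/lie_classW=> t; elim/lie_classW=> u.
by rewrite !presE; apply/lie_classP/EqvAddA.
Qed.

Fact pres_addC : commutative pres_add.
Proof.
elim/lie_classW=> s; elim/lie_classW=> t.
by rewrite !presE; apply/lie_classP/EqvAddC.
Qed.

Fact pres_add0 : left_id (lie_class LZero) pres_add.
Proof. by elim/lie_classW=> t; rewrite presE; apply/lie_classP/EqvAdd0. Qed.

Fact pres_addN : left_inverse (lie_class LZero) pres_opp pres_add.
Proof. by elim/lie_classW=> t; rewrite !presE; apply/lie_classP/EqvAddN. Qed.

HB.instance Definition _ := GRing.isZmodule.Build presented_lie
  pres_addA pres_addC pres_add0 pres_addN.

Fact pres_scaleA a b x : pres_scale a (pres_scale b x) = pres_scale (a * b) x.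
Proof.
by elim/lie_classW: x => t; rewrite !presE; apply/lie_classP/EqvScaleA.
Qed.

Fact pres_scale1 : left_id 1 pres_scale.
Proof. by elim/lie_classW=> t; rewrite presE; apply/lie_classP/EqvScale1. Qed.

Fact pres_scaleDr : right_distributive pres_scale +%R.
Proof.
move=> a; elim/lie_classW=> s; elim/lie_classW=> t.
by rewrite /GRing.add /= !presE; apply/lie_classP/EqvScaleDr.
Qed.

Fact pres_scaleDl x : {morph pres_scale^~ x : a b / a + b}.
Proof.
elim/lie_classW: x => t a b.
by rewrite [RHS]/GRing.add /= !presE; apply/lie_classP/EqvScaleDl.
Qed.

HB.instance Definition _ := GRing.Zmodule_isLmodule.Build K presented_lie
  pres_scaleA pres_scale1 pres_scaleDr pres_scaleDl.

Fact lie_classD s t : lie_class (LAdd s t) = lie_class s + lie_class t.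
Proof. by rewrite -pres_addE. Qed.

Fact lie_classZ a t : lie_class (LScale a t) = a *: lie_class t.
Proof. by rewrite -pres_scaleE. Qed.

Fact pres_linearl y : linear (fun x => pres_bracket x y).
Proof.
move=> a; elim/lie_classW: y => u; elim/lie_classW=> s; elim/lie_classW=> t.
rewrite -lie_classZ -lie_classD !presE -lie_classZ -lie_classD.
exact/lie_classP/EqvBracketl.
Qed.

Fact pres_linearr x : linear (pres_bracket x).
Proof.
move=> a; elim/lie_classW: x => u; elim/lie_classW=> s; elim/lie_classW=> t.
rewrite -lie_classZ -lie_classD !presE -lie_classZ -lie_classD.
exact/lie_classP/EqvBracketr.
Qed.

Fact pres_xx x : pres_bracket x x = 0.
Proof.
by elim/lie_classW: x => t; rewrite presE; apply/lie_classP/EqvBracketxx.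
Qed.

Fact pres_jacobi x y z :
  pres_bracket x (pres_bracket y z) + pres_bracket y (pres_bracket z x)
    + pres_bracket z (pres_bracket x y) = 0.
Proof.
elim/lie_classW: x => s; elim/lie_classW: y => t; elim/lie_classW: z => u.
by rewrite !presE -!lie_classD; apply/lie_classP/EqvJacobi.
Qed.

HB.instance Definition _ := Lmodule_isLie.Build K presented_lie
  pres_linearl pres_linearr pres_xx pres_jacobi.

End Presentation.

Fixpoint lie_eval (K : fieldType) (I : Type) (L : lieAlgType K) (f : I -> L)
    (t : lie_term K I) : L :=
  match t with
  | LGen i => f i
  | LZero => 0
  | LOpp s => - lie_eval f s
  | LAdd s u => lie_eval f s + lie_eval f u
  | LScale a s => a *: lie_eval f s
  | LBracket s u => bracket (lie_eval f s) (lie_eval f u)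
  end.

Section Universal.
Variables (K : fieldType) (I : Type).
Variable rels : lie_term K I -> lie_term K I -> Prop.
Local Notation P := (presented_lie rels).

Lemma lie_eval_gen t : lie_eval (lie_gen rels) t = lie_class rels t.
Proof.
elim: t => [i||s IH|s IHs u IHu|a s IH|s IHs u IHu] //=.
- by rewrite IH [LHS]pres_oppE.
- by rewrite IHs IHu lie_classD.
- by rewrite IH lie_classZ.
- by rewrite IHs IHu [LHS]pres_bracketE.
Qed.

Lemma presented_lie_rel s t : rels s t ->
  lie_eval (lie_gen rels) s = lie_eval (lie_gen rels) t.
Proof. by move=> st; rewrite !lie_eval_gen; apply/lie_classP/EqvRel. Qed.

Variables (L : lieAlgType K) (f : I -> L).
Hypothesis f_rel : forall s t, rels s t -> lie_eval f s = lie_eval f t.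

Lemma lie_eval_eqv s t : lie_eqv rels s t -> lie_eval f s = lie_eval f t.
Proof.
elim=> //=.
- by move=> ? ? ? _ -> _ ->.
- by move=> ? ? _ ->.
- by move=> ? ? ? ? _ -> _ ->.
- by move=> ? ? ? _ ->.
- by move=> ? ? ? ? _ -> _ ->.
- by move=> ? ? ?; rewrite addrA.
- by move=> ? ?; rewrite addrC.
- by move=> ?; rewrite add0r.
- by move=> ?; rewrite addNr.
- by move=> ? ? ?; rewrite scalerA.
- by move=> ?; rewrite scale1r.
- by move=> ? ? ?; rewrite scalerDr.
- by move=> ? ? ?; rewrite scalerDl.
- by move=> ? ? ? ?; exact: bracket_linearl.
- by move=> ? ? ? ?; exact: bracket_linearr.
- by move=> ?; rewrite bracketxx.
- by move=> ? ? ?; rewrite bracket_jacobi.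
Qed.

Let F (x : P) : L := lie_eval f (repr x).

Let FE t : F (lie_class rels t) = lie_eval f t.
Proof. exact/lie_eval_eqv/repr_class. Qed.

Let F_linear : linear F.
Proof.
move=> a; elim/lie_classW=> s; elim/lie_classW=> t.
by rewrite -lie_classZ -lie_classD !FE.
Qed.

HB.instance Definition _ := GRing.isLinear.Build K P L *:%R F F_linear.

Lemma presented_lie_universal :
  exists2 F : {linear P -> L}, lie_morphism F
    & forall i, F (lie_gen rels i) = f i.
Proof.
exists F => [|i]; last exact: FE.
elim/lie_classW=> s; elim/lie_classW=> t /=.
by rewrite [bracket _ _]pres_bracketE !FE.
Qed.

Lemma presented_lie_unique (F1 F2 : {linear P -> L}) :
    lie_morphism F1 -> lie_morphism F2 ->
    (forall i, F1 (lie_gen rels i) = F2 (lie_gen rels i)) ->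
  F1 =1 F2.
Proof.
move=> m1 m2 E; elim/lie_classW=> t; rewrite -lie_eval_gen.
elim: t => [i||s IH|s IHs u IHu|a s IH|s IHs u IHu] /=.
- exact: E.
- by rewrite !linear0.
- by rewrite !linearN IH.
- by rewrite !linearD IHs IHu.
- by rewrite !linearZ IH.
- by rewrite m1 m2 IHs IHu.
Qed.

End Universal.

(* The generators [e_1, ..., e_m] are indexed by [0, ..., m - 1]. *)
Inductive electrical_rel (K : fieldType) (m : nat) :
    lie_term K 'I_m -> lie_term K 'I_m -> Prop :=
| ElecFar (i j : 'I_m) of (2 <= `|i - j|)%N :
    electrical_rel (LBracket (LGen i) (LGen j)) LZero
| ElecNear (i j : 'I_m) of `|i - j|%N = 1%N :
    electrical_rel (LBracket (LGen i) (LBracket (LGen i) (LGen j)))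
                   (LScale (- 2) (LGen i)).

Definition electricalA (K : fieldType) (m : nat) : lieAlgType K :=
  presented_lie (@electrical_rel K m).

(* Main.v *)
(** Let [W] be the space with basis [v_0, ..., v_(m-1)] and the alternating
    form for which only consecutive basis vectors pair nontrivially, with
    [(v_i, v_j) = (-1)^i].  With [Om] the Gram matrix, [Sym^2 W] is the Lie
    algebra of symmetric matrices under [A Om B - B Om A], and
    [e_k |-> (-1)^k v_k^2] satisfies the electrical relations.  Conversely,
    iterated brackets of generators give elements of the electrical algebra on
    which each [ad e_k] acts as on the products [v_i v_j]; this yields an
    inverse map, so [e_(A_m)] is isomorphic to [Sym^2 W].
    For [m = 2n + 1] the form has a one-dimensional radical [<z>] and
    [W = V + <z>] with [V] symplectic of dimension [2n].  Hence
    [Sym^2 W = Sym^2 V + V z + <z^2>], where [Sym^2 V = sp_(2n)], the element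
    [z^2] is central, and modulo [z^2] the summand [V z] is an abelian ideal
    carrying the standard representation. *)
Require Import Defs.
From HB Require Import structures.
From mathcomp Require Import all_boot all_order all_algebra.
From mathcomp Require Import boolp reals complex zify.

Set Implicit Arguments.
Unset Strict Implicit.
Unset Printing Implicit Defensive.

Import GRing.Theory.
Local Open Scope ring_scope.

(** * Bilinear identities and the derivation rule for brackets *)

Section LieTheory.
Variables (K : fieldType) (L : lieAlgType K).
Implicit Types x y z : L.

HB.instance Definition _ x :=
  GRing.isLinear.Build K L L *:%R (bracket x) (@bracket_linearr K L x).

Lemma bracketDr x y z : bracket x (y + z) = bracket x y + bracket x z.
Proof. exact: linearD. Qed.

Lemma bracketNr x y : bracket x (- y) = - bracket x y.
Proof. exact: linearN. Qed.

Lemma bracketZr a x y : bracket x (a *: y) = a *: bracket x y.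
Proof. exact: linearZ. Qed.

Lemma bracketr0 x : bracket x 0 = 0.
Proof. exact: linear0. Qed.

Lemma bracketDl x y z : bracket (x + y) z = bracket x z + bracket y z.
Proof. by have := bracket_linearl z 1 x y; rewrite !scale1r. Qed.

Lemma bracketC x y : bracket x y = - bracket y x.
Proof.
apply/eqP; rewrite -addr_eq0; apply/eqP; have := bracketxx (x + y).
by rewrite bracketDl !bracketDr !bracketxx add0r addr0.
Qed.

Lemma bracketZl a x y : bracket (a *: x) y = a *: bracket x y.
Proof. by rewrite bracketC bracketZr -scalerN -bracketC. Qed.

Lemma bracketNl x y : bracket (- x) y = - bracket x y.
Proof. by rewrite -scaleN1r bracketZl scaleN1r. Qed.

Lemma bracket0l x : bracket 0 x = 0.
Proof. by rewrite bracketC bracketr0 oppr0. Qed.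

Lemma bracket_derivation x y z :
  bracket x (bracket y z) = bracket (bracket x y) z + bracket y (bracket x z).
Proof.
rewrite (bracketC (bracket x y)) (bracketC x z) bracketNr -opprD.
apply/eqP; rewrite -addr_eq0 [bracket z _ + _]addrC addrA; apply/eqP.
exact: bracket_jacobi.
Qed.

End LieTheory.

(** * Root vectors of the electrical algebra *)

Definition adjacent (k i : nat) := (k.+1 == i) || (i.+1 == k).

Lemma adjacentS k : adjacent k k.+1.
Proof. by rewrite /adjacent eqxx. Qed.

Lemma adjacentSl k : adjacent k.+1 k.
Proof. by rewrite /adjacent eqxx orbT. Qed.

Lemma adjacentxx k : adjacent k k = false.
Proof. by rewrite /adjacent; lia. Qed.

Lemma adjacent_far k i : (k.+2 <= i)%N -> adjacent k i = false.
Proof. by rewrite /adjacent; lia. Qed.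

Lemma adjacent_farl k i : (k.+2 <= i)%N -> adjacent i k = false.
Proof. by rewrite /adjacent; lia. Qed.

Lemma adjacentC i j : adjacent i j = adjacent j i.
Proof. by rewrite /adjacent orbC. Qed.

Section RootVectors.
Variables (K : fieldType) (L : lieAlgType K) (m : nat) (g : nat -> L).

Fixpoint root_vec (i d : nat) : L :=
  if d is d'.+1 then bracket (g i) (root_vec i.+1 d') else g i.

(* [root_prod i j] is the element that corresponds to the symmetric tensor
   [v_i v_j + v_j v_i], whence the factor [2] on the diagonal; the signs make
   all coefficients in [bracket_root_prod] equal to [1]. *)
Definition root_prod (i j : nat) : L :=
  ((i == j).+1%:R * (-1) ^+ maxn i j)
    *: root_vec (minn i j) (maxn i j - minn i j).

Lemma root_prodC i j : root_prod i j = root_prod j i.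
Proof. by rewrite /root_prod eq_sym maxnC minnC. Qed.

Lemma root_prodii i : root_prod i i = (2 * (-1) ^+ i) *: g i.
Proof. by rewrite /root_prod eqxx minnn maxnn subnn. Qed.

Lemma root_prodSd i d :
  root_prod i (i + d).+1 = (-1) ^+ (i + d).+1 *: root_vec i d.+1.
Proof.
rewrite /root_prod (_ : i == _ = false); last by lia.
rewrite (maxn_idPr _) ?(minn_idPl _); try lia.
by rewrite mul1r; congr (_ *: root_vec _ _); lia.
Qed.

Lemma root_prodS i :
  root_prod i i.+1 = (-1) ^+ i.+1 *: bracket (g i) (g i.+1).
Proof. by have := root_prodSd i 0; rewrite addn0. Qed.

Lemma root_prod_step i j : (i.+1 < j)%N ->
  bracket (g i) (root_prod i.+1 j) = root_prod i j.
Proof.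
move=> lt_ij; rewrite -(subnKC lt_ij) addSn root_prodSd -addSn.
by rewrite addSnnS root_prodSd bracketZr.
Qed.

Hypothesis g_far : forall i j, (i.+2 <= j)%N -> bracket (g i) (g j) = 0.

Lemma root_vec_farl k i d : (k.+2 <= i)%N -> bracket (g k) (root_vec i d) = 0.
Proof.
elim: d i => [|d IHd] i le_ki /=; first exact: g_far.
rewrite bracket_derivation g_far // IHd; last by lia.
by rewrite bracketr0 bracket0l addr0.
Qed.

Lemma root_prod_farl k i j : (k.+2 <= i)%N -> (k.+2 <= j)%N ->
  bracket (g k) (root_prod i j) = 0.
Proof. by move=> *; rewrite bracketZr root_vec_farl ?scaler0; last lia. Qed.

(** For adjacent indices the bracket of two generators is, up to sign, a root product by definition;
    the factor 2 is that of [root_prod i i]. *)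
Lemma bracket_root_prod_diag k i :
  bracket (g k) (root_prod i i) = (2 * (adjacent k i)%:R) *: root_prod k i.
Proof.
rewrite root_prodii bracketZr.
case: (ltngtP k i) => [lt_ki|lt_ik|->].
- have [->|ne_ki] := eqVneq i k.+1.
    by rewrite adjacentS mulr1 root_prodS scalerA.
  by rewrite g_far ?adjacent_far ?mulr0 ?scale0r ?scaler0 //; lia.
- have [->|ne_ki] := eqVneq k i.+1.
    rewrite adjacentSl mulr1 root_prodC root_prodS scalerA.
    by rewrite bracketC exprS mulN1r mulrN scaleNr scalerN.
  rewrite bracketC g_far ?adjacent_farl ?mulr0 ?scale0r; try lia.
  by rewrite oppr0 scaler0.
- by rewrite bracketxx scaler0 adjacentxx mulr0 scale0r.
Qed.

Hypothesis two_neq0 : 2 != 0 :> K.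
Hypothesis g_nearl : forall i, (i.+1 < m)%N ->
  bracket (g i) (bracket (g i) (g i.+1)) = - 2 *: g i.
Hypothesis g_nearr : forall i, (i.+1 < m)%N ->
  bracket (g i.+1) (bracket (g i.+1) (g i)) = - 2 *: g i.+1.

(** The inner factor [c] commutes with [g i], so the left side is [[[g i, [g i, g i.+1]], c]], a
    multiple of [[g i, c] = 0]. *)
Lemma root_vec_same2 i d : (i.+1 < m)%N -> bracket (g i) (root_vec i d.+2) = 0.
Proof.
move=> lt_im /=; set c := root_vec _ d.
have gc : bracket (g i) c = 0 by apply: root_vec_farl.
rewrite [bracket (g i) (bracket (g i.+1) c)]bracket_derivation gc bracketr0.
by rewrite addr0 bracket_derivation gc bracketr0 addr0 g_nearl // bracketZl gc
  scaler0.
Qed.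

Lemma root_vec_succ1 i : (i.+1 < m)%N ->
  bracket (g i.+1) (root_vec i 1) = 2 *: g i.+1.
Proof.
move=> lt_im /=.
by rewrite [bracket (g i) _]bracketC bracketNr g_nearr // scaleNr opprK.
Qed.

(* Applying [ad (g i.+1)] twice to [[g i, c] = 0] computes
   [[[g i.+1, g i], [g i.+1, c]]]. *)
Lemma root_vec_succ_gen i c s : (i.+1 < m)%N ->
    bracket (g i) c = 0 ->
    bracket (g i.+1) (bracket (g i.+1) c) = (2 * s) *: g i.+1 ->
  bracket (g i.+1) (bracket (g i) (bracket (g i.+1) c))
    = bracket (g i.+1) c + s *: bracket (g i) (g i.+1).
Proof.
move=> lt_im ac; have := g_nearr lt_im.
set a := g i; set b := g i.+1 => bba bbc.
have: bracket b (bracket b (bracket a c)) = 0 by rewrite ac !bracketr0.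
rewrite (bracket_derivation b a c) bracketDr.
rewrite (bracket_derivation b (bracket b a) c) (bracket_derivation b a).
rewrite bba bbc bracketZl bracketZr.
set w := bracket (bracket b a) _; set u := bracket b c; set v := bracket a b.
rewrite addrA -[_ + w + w]addrA -mulr2n -scaler_nat -scalerA scaleNr -scalerN.
rewrite -!scalerDr => /eqP; rewrite scaler_eq0 (negPf two_neq0) /=.
rewrite -addrA addr_eq0 eqr_opp => /eqP ->.
by rewrite -addrA -mulr2n -scaler_nat.
Qed.

(** [ad (g k)] acts as a derivation on [v_i v_j]. The cases follow the position of [k] relative to
    [i]; the near relations enter directly only for [k = i] and [k = i.+1]. *)
Lemma bracket_root_prod_le k i d : (i + d < m)%N -> (k < m)%N ->
  bracket (g k) (root_prod i (i + d))
    = (adjacent k i)%:R *: root_prod k (i + d)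
      + (adjacent k (i + d))%:R *: root_prod k i.
Proof.
elim: d i => [|d IHd] i lt_dm lt_km.
  by rewrite addn0 bracket_root_prod_diag -scalerDl mulr_natl mulr2n.
have [le_ki|le_ik] := ltnP k i.
  rewrite (adjacent_far (i := i + d.+1)) ?scale0r ?addr0; last by lia.
  have [i_eq|ne_ik] := eqVneq i k.+1.
    by rewrite i_eq adjacentS scale1r root_prod_step //; lia.
  by rewrite root_prod_farl ?adjacent_far ?scale0r //; lia.
have [<-|ne_ik] := eqVneq i k.
  rewrite adjacentxx scale0r add0r addnS root_prodSd bracketZr.
  case: d {IHd} lt_dm => [|d] lt_dm.
    rewrite addn0 adjacentS scale1r root_prodii /= g_nearl //; last by lia.
    by rewrite scalerA exprS mulrN mulN1r mulNr opprK mulrC.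
  by rewrite root_vec_same2 ?adjacent_far ?scale0r ?scaler0 //; lia.
have [->|ne_kSi] := eqVneq k i.+1.
  rewrite adjacentSl scale1r addnS root_prodSd bracketZr.
  case: d {IHd} lt_dm => [|[|d]] lt_dm.
  - rewrite addn0 adjacentxx scale0r addr0 root_vec_succ1; last by lia.
    by rewrite root_prodii scalerA mulrC.
  - rewrite addn1 adjacentS scale1r [root_prod i.+1 i]root_prodC !root_prodS /=.
    (* Here [s = -1] by the near relation; for longer root vectors the double bracket vanishes and
       [s = 0]. *)
    rewrite (@root_vec_succ_gen i (g i.+2) (-1)); [|lia|exact: g_far|].
      rewrite scaleN1r scalerBr; congr (_ + _).
      by rewrite exprS mulN1r scaleNr opprK.
    by rewrite g_nearl ?mulrN1 //; lia.
  rewrite adjacent_far ?scale0r ?addr0 /=; last by lia.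
  rewrite (@root_vec_succ_gen i (root_vec i.+2 d.+1) 0); first last.
  - rewrite mulr0 scale0r -[bracket _ (root_vec _ _)]/(root_vec i.+1 d.+2).
    by rewrite root_vec_same2 //; lia.
  - by rewrite root_vec_farl.
  - by lia.
  rewrite scale0r addr0.
  rewrite (_ : (i + d.+2).+1 = (i.+1 + d.+1).+1)%N; last by lia.
  by rewrite root_prodSd.
have lt_ik : (i.+2 <= k)%N by lia.
rewrite (adjacent_farl (k := i)) // scale0r add0r.
(* Gap 1 is separate: peeling off [g i] would leave a diagonal product, whose factor 2 breaks
   [root_prod_step]. *)
case: d IHd lt_dm => [|d] IHd lt_dm.
  rewrite addn1 root_prodS bracketZr bracket_derivation.
  rewrite [bracket (g k) (g i)]bracketC g_far // oppr0 bracket0l add0r.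
  have [->|ne_kSSi] := eqVneq k i.+2.
    rewrite adjacentSl scale1r [RHS]root_prodC -root_prod_step //.
    rewrite root_prodS bracketZr [bracket (g i.+2) _]bracketC bracketNr.
    by rewrite [in RHS]exprS mulN1r scaleNr scalerN.
  rewrite [bracket (g k) _]bracketC g_far; last by lia.
  by rewrite adjacent_farl ?scale0r ?oppr0 ?bracketr0 ?scaler0 //; lia.
(* As [g k] commutes with [g i], the induction hypothesis applies inside. Of its two terms, [g i]
   kills the one without index [i.+1] and lowers [i.+1] to [i] in the other. *)
rewrite -root_prod_step; last by lia.
rewrite bracket_derivation [bracket (g k) (g i)]bracketC g_far //.
rewrite oppr0 bracket0l add0r addnS -addSn IHd //; last by lia.
rewrite bracketDr 2!bracketZr (root_prod_farl (k := i)) //; last by lia.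
by rewrite scaler0 add0r ![root_prod k _]root_prodC root_prod_step.
Qed.

Lemma bracket_root_prod i j k : (i < m)%N -> (j < m)%N -> (k < m)%N ->
  bracket (g k) (root_prod i j)
    = (adjacent k i)%:R *: root_prod k j + (adjacent k j)%:R *: root_prod k i.
Proof.
move=> lt_im lt_jm lt_km; have [le_ij|/ltnW le_ji] := leqP i j.
  by rewrite -(subnKC le_ij) bracket_root_prod_le // subnKC.
by rewrite root_prodC addrC -(subnKC le_ji) bracket_root_prod_le // subnKC.
Qed.

End RootVectors.

(** * The symmetric square of the chain *)

Section ChainLie.
Variables (K : fieldType) (m : nat).

Definition chain_form : 'M[K]_m :=
  \matrix_(i, j) ((-1) ^+ i * (adjacent i j)%:R).

(** Adjacent indices have opposite parity, which makes [chain_form] skew. *)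
Lemma sign_adjacent i j :
  (-1) ^+ i * (adjacent i j)%:R = - (-1) ^+ j * (adjacent i j)%:R :> K.
Proof.
rewrite /adjacent; have [<-|_] /= := eqVneq i.+1 j.
  by rewrite exprS mulN1r opprK.
by have [<-|_] := eqVneq j.+1 i; rewrite ?mulr0 // exprS mulN1r.
Qed.

Lemma chain_form_tr : chain_form^T = - chain_form.
Proof.
by apply/matrixP=> i j; rewrite !mxE sign_adjacent adjacentC mulNr.
Qed.

Definition is_symmx : {pred 'M[K]_m} := [pred A : 'M[K]_m | A^T == A].

Record symmx :=
  Symmx { symmx_mx :> 'M[K]_m; symmx_mxP : symmx_mx \in is_symmx }.

HB.instance Definition _ := [isSub for symmx_mx].
HB.instance Definition _ := [Choice of symmx by <:].

Fact is_symmx_submod : submod_closed is_symmx.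
Proof.
split=> [|a A B]; first by rewrite inE trmx0.
by rewrite !inE linearP /= => /eqP-> /eqP->.
Qed.

HB.instance Definition _ :=
  GRing.isSubmodClosed.Build K _ is_symmx is_symmx_submod.
HB.instance Definition _ := [SubChoice_isSubLmodule of symmx by <:].

Lemma symmx_tr (A : symmx) : (A : 'M_m)^T = A.
Proof. exact/eqP/(symmx_mxP A). Qed.

(** The commutator of the associative product [A *m chain_form *m B]; skewness of the form makes it
    symmetric. *)
Fact is_symmx_comm (A B : symmx) :
  A *m chain_form *m B - B *m chain_form *m A \in is_symmx.
Proof.
rewrite inE linearB /= !trmx_mul !symmx_tr chain_form_tr !mulmxA.
by rewrite !mulmxN !mulNmx opprK addrC.
Qed.

Definition symmx_bracket (A B : symmx) : symmx := Symmx (is_symmx_comm A B).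

Fact symmx_linearl B : linear (fun A => symmx_bracket A B).
Proof.
move=> a A1 A2; apply/val_inj => /=.
by rewrite !mulmxDl mulmxDr -!scalemxAl -scalemxAr scalerBr opprD addrACA.
Qed.

Fact symmx_linearr A : linear (symmx_bracket A).
Proof.
move=> a A1 A2; apply/val_inj => /=.
by rewrite !mulmxDl mulmxDr -!scalemxAl -scalemxAr scalerBr opprD addrACA.
Qed.

Fact symmx_xx A : symmx_bracket A A = 0.
Proof. by apply/val_inj; rewrite /= subrr. Qed.

Fact symmx_jacobi A B C :
  symmx_bracket A (symmx_bracket B C) + symmx_bracket B (symmx_bracket C A)
    + symmx_bracket C (symmx_bracket A B) = 0.
Proof.
apply/val_inj => /=; rewrite !mulmxBl !mulmxBr !mulmxA !opprB.
rewrite (AC ((2*2)*(2*2)*(2*2)) ((1*12)*(2*7)*(3*10)*(4*5)*(6*11)*(8*9))).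
by rewrite /= !subrr !addNr !addr0.
Qed.

HB.instance Definition _ := Lmodule_isLie.Build K symmx
  symmx_linearl symmx_linearr symmx_xx symmx_jacobi.

Fact symmx_gen_proof (k : 'I_m) : (-1) ^+ k *: delta_mx k k \in is_symmx.
Proof. by rewrite inE linearZ /= trmx_delta. Qed.

Definition symmx_gen k : symmx := Symmx (symmx_gen_proof k).

Fact symmx_prod_proof (i j : 'I_m) : delta_mx i j + delta_mx j i \in is_symmx.
Proof. by rewrite inE linearD /= !trmx_delta addrC. Qed.

Definition symmx_prod i j : symmx := Symmx (symmx_prod_proof i j).

Lemma mul_delta_mx_delta (A : 'M[K]_m) (i j k l : 'I_m) :
  delta_mx i j *m A *m delta_mx k l = A j k *: delta_mx i l.
Proof.
apply/matrixP=> a b; rewrite -mulmxA !mxE.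
rewrite (bigD1 j) //= big1 ?addr0 => [|c /negPf cj].
  rewrite !mxE eqxx andbT (bigD1 k) //= big1 ?addr0 => [|c /negPf ck].
    by rewrite !mxE eqxx /= mulrCA -natrM mulnb.
  by rewrite !mxE ck mulr0.
by rewrite !mxE cj andbF mul0r.
Qed.

(** The coefficients agree with [bracket_root_prod]: the sign of the generator cancels the one in
    row [k] of the form. *)
Lemma bracket_symmx_prod k i j :
  bracket (symmx_gen k) (symmx_prod i j)
    = (adjacent k i)%:R *: symmx_prod k j + (adjacent k j)%:R *: symmx_prod k i.
Proof.
apply/val_inj => /=.
rewrite !mulmxDr !mulmxDl -!scalemxAl -!scalemxAr !mul_delta_mx_delta.
rewrite !mxE (sign_adjacent i k) (sign_adjacent j k).
rewrite (adjacentC i k) (adjacentC j k) !scalerA !mulNr !mulrN !signrMK.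
by rewrite !scaleNr opprD !opprK !scalerDr [_ *: delta_mx i k + _]addrC addrACA.
Qed.

Lemma symmx_prodC i j : symmx_prod i j = symmx_prod j i.
Proof. by apply/val_inj; rewrite /= addrC. Qed.

Lemma symmx_prodii i : symmx_prod i i = (2 * (-1) ^+ i) *: symmx_gen i.
Proof.
by apply/val_inj; rewrite /= scalerA -mulrA -expr2 sqrr_sign mulr1 scaler_nat.
Qed.

Hypothesis two_neq0 : 2 != 0 :> K.

Lemma symmx_gen_prod i : symmx_gen i = (2^-1 * (-1) ^+ i) *: symmx_prod i i.
Proof.
by rewrite symmx_prodii scalerA mulrACA mulVf // mul1r -expr2 sqrr_sign scale1r.
Qed.

Lemma symmx_decomp (A : symmx) :
  A = \sum_i \sum_j (2^-1 * (A : 'M_m) i j) *: symmx_prod i j.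
Proof.
apply/val_inj; rewrite raddf_sum.
under eq_bigr do rewrite raddf_sum /=.
have ->: \sum_i \sum_j (2^-1 * (A : 'M_m) i j) *: (delta_mx i j + delta_mx j i)
    = 2^-1 *: ((A : 'M_m) + (A : 'M_m)^T).
  rewrite [in RHS](matrix_sum_delta (A : 'M_m)) linear_sum -big_split.
  rewrite scaler_sumr /=; apply: eq_bigr => i _.
  rewrite linear_sum -big_split scaler_sumr /=.
  by apply: eq_bigr => j _; rewrite linearZ /= trmx_delta -scalerDr scalerA.
by rewrite symmx_tr -mulr2n -scaler_nat scalerA mulVf // scale1r.
Qed.

Lemma bracket_symmx_gen k i :
  bracket (symmx_gen k) (symmx_gen i)
    = ((-1) ^+ i * (adjacent k i)%:R) *: symmx_prod k i.
Proof.
rewrite [symmx_gen i]symmx_gen_prod bracketZr bracket_symmx_prod -scalerDl.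
rewrite scalerA (_ : _ + _ = 2 * (adjacent k i)%:R); last first.
  by rewrite mulr_natl mulr2n.
by rewrite mulrACA mulVf // mul1r.
Qed.

Lemma electrical_rel_symmx s t : electrical_rel s t ->
  lie_eval symmx_gen s = lie_eval symmx_gen t.
Proof.
case=> i j /= ij.
  rewrite bracket_symmx_gen (_ : adjacent i j = false); last first.
    by rewrite /adjacent; lia.
  by rewrite mulr0 scale0r.
have aij : adjacent i j by rewrite /adjacent; lia.
have sij : (-1) ^+ i = - (-1) ^+ j :> K.
  by have := sign_adjacent i j; rewrite aij !mulr1.
rewrite bracket_symmx_gen bracketZr bracket_symmx_prod adjacentxx aij.
rewrite scale0r add0r scale1r mulr1 symmx_prodii scalerA.
by rewrite sij !mulrN mulrCA -expr2 sqrr_sign mulr1.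
Qed.

End ChainLie.
(** * The isomorphism with the symmetric square *)

Lemma presented_lie_ind (K : fieldType) (I : Type)
    (rels : lie_term K I -> lie_term K I -> Prop)
    (P : presented_lie rels -> Prop) :
    (forall i, P (lie_gen rels i)) -> P 0 ->
    (forall x, P x -> P (- x)) -> (forall x y, P x -> P y -> P (x + y)) ->
    (forall a x, P x -> P (a *: x)) ->
    (forall x y, P x -> P y -> P (bracket x y)) ->
  forall x, P x.
Proof.
move=> Pgen P0 PN PD PZ Pbr; elim/lie_classW=> t; rewrite -lie_eval_gen.
by elim: t => /=; auto.
Qed.

(** The elements whose adjoint action commutes with [F] are closed under all Lie operations, hence
    are everything; a second induction gives [F x = x]. For [psi \o phi] this asks of [psi] only
    linearity and compatibility with the generators. *)
Lemma presented_lie_equivariant_id (K : fieldType) (I : Type)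
    (rels : lie_term K I -> lie_term K I -> Prop)
    (F : {linear presented_lie rels -> presented_lie rels}) :
    (forall i, F (lie_gen rels i) = lie_gen rels i) ->
    (forall i x,
      F (bracket (lie_gen rels i) x) = bracket (lie_gen rels i) (F x)) ->
  forall x, F x = x.
Proof.
move=> Fgen Fbr.
have Feq x y : F (bracket x y) = bracket x (F y).
  elim/presented_lie_ind: x y => [i||x IH|x1 x2 IH1 IH2|a x IH|x1 x2 IH1 IH2] y.
  - exact: Fbr.
  - by rewrite !bracket0l linear0.
  - by rewrite !bracketNl linearN IH.
  - by rewrite !bracketDl linearD IH1 IH2.
  - by rewrite !bracketZl linearZ /= IH.
  have br12 z : bracket (bracket x1 x2) z
      = bracket x1 (bracket x2 z) - bracket x2 (bracket x1 z).
    by rewrite bracket_derivation addrK.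
  by rewrite !br12 linearB !IH1 !IH2 IH1.
elim/presented_lie_ind => [i||x IH|x y IHx IHy|a x IH|x y IHx IHy].
- exact: Fgen.
- exact: linear0.
- by rewrite linearN IH.
- by rewrite linearD IHx IHy.
- by rewrite linearZ /= IH.
- by rewrite Feq IHy.
Qed.

Section ElectricalIso.
Variables (K : fieldType) (m : nat).
Hypothesis two_neq0 : 2 != 0 :> K.
Local Notation e_m := (electricalA K m).

Let gen (i : 'I_m) : e_m := lie_gen (@electrical_rel K m) i.
(** Extension by 0 keeps the far relations true for all natural indices, as [root_vec] recurses
    without a bound. *)
Let g (k : nat) : e_m := oapp gen 0 (insub k).

Let g_ord (i : 'I_m) : g i = gen i.
Proof. by rewrite /g valK. Qed.

Let g_far i j : (i.+2 <= j)%N -> bracket (g i) (g j) = 0.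
Proof.
rewrite /g => le_ij; case: insubP => [i' _ Ei|_] /=; last by rewrite bracket0l.
case: insubP => [j' _ Ej|_] /=; last by rewrite bracketr0.
by apply: (presented_lie_rel (@ElecFar K m i' j' _)); rewrite Ei Ej; lia.
Qed.

Let g_near (i j : 'I_m) : adjacent i j ->
  bracket (g i) (bracket (g i) (g j)) = - 2 *: g i.
Proof.
rewrite !g_ord => aij; apply: (presented_lie_rel (@ElecNear K m i j _)).
by move: aij; rewrite /adjacent; lia.
Qed.

Let g_nearl i : (i.+1 < m)%N ->
  bracket (g i) (bracket (g i) (g i.+1)) = - 2 *: g i.
Proof.
move=> lt_im.
exact: (@g_near (Ordinal (ltnW lt_im)) (Ordinal lt_im) (adjacentS i)).
Qed.

Let g_nearr i : (i.+1 < m)%N ->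
  bracket (g i.+1) (bracket (g i.+1) (g i)) = - 2 *: g i.+1.
Proof.
move=> lt_im.
exact: (@g_near (Ordinal lt_im) (Ordinal (ltnW lt_im)) (adjacentSl i)).
Qed.

(** The coefficients are those of [symmx_decomp], so that [symmx_prod] goes to [root_prod]. *)
Let psi (A : symmx K m) : e_m :=
  \sum_i \sum_j (2^-1 * (A : 'M_m) i j) *: root_prod g i j.

Let psi_linear : linear psi.
Proof.
move=> a A B.
have valD i j :
    (a *: A + B : symmx K m) i j = a * (A : 'M_m) i j + (B : 'M_m) i j.
  by rewrite [LHS]/= !mxE.
rewrite /psi scaler_sumr -big_split; apply: eq_bigr => i _.
rewrite scaler_sumr -big_split; apply: eq_bigr => j _.
by rewrite valD mulrDr scalerDl [a *: _]scalerA mulrCA.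
Qed.

HB.instance Definition _ :=
  GRing.isLinear.Build K (symmx K m) e_m *:%R psi psi_linear.

Let psi_prod i j : psi (symmx_prod K i j) = root_prod g i j.
Proof.
rewrite /psi.
under eq_bigr => a _ do under eq_bigr => b _ do rewrite !mxE mulrDr scalerDl.
under eq_bigr do rewrite big_split /=.
rewrite big_split /=.
have pick (c d : 'I_m) :
  \sum_a \sum_b (2^-1 * ((a == c) && (b == d))%:R) *: root_prod g a b
    = 2^-1 *: root_prod g c d.
  rewrite (bigD1 c) //= [X in _ + X]big1 ?addr0 => [|a /negPf ac]; last first.
    by rewrite big1 // => b _; rewrite ac mulr0 scale0r.
  rewrite (bigD1 d) //= [X in _ + X]big1 ?addr0 => [|b /negPf bd].
    by rewrite !eqxx mulr1.
  by rewrite bd andbF mulr0 scale0r.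
rewrite !pick [root_prod g j i]root_prodC -mulr2n -scaler_nat scalerA.
by rewrite divff // scale1r.
Qed.

Let psi_gen k : psi (symmx_gen K k) = g k.
Proof.
rewrite symmx_gen_prod // linearZ /= psi_prod root_prodii scalerA.
by rewrite mulrACA mulVf // mul1r -expr2 sqrr_sign scale1r.
Qed.

(** By linearity it suffices to treat products, where both brackets have the same coefficients. *)
Let psi_bracket k A : psi (bracket (symmx_gen K k) A) = bracket (g k) (psi A).
Proof.
have psi_bracket_prod c i j :
    psi (bracket (symmx_gen K k) (c *: symmx_prod K i j))
      = bracket (g k) (psi (c *: symmx_prod K i j)).
  rewrite bracketZr !(linearZ_LR psi) bracketZr bracket_symmx_prod.
  rewrite (linearD psi) !(linearZ_LR psi) /= !psi_prod.
  by rewrite (@bracket_root_prod K e_m m).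
rewrite [A]symmx_decomp // (linear_sum psi) !(linear_sum (bracket _)).
rewrite (linear_sum psi); apply: eq_bigr => i _.
rewrite (linear_sum psi) !(linear_sum (bracket _)) (linear_sum psi).
by apply: eq_bigr => j _; apply: psi_bracket_prod.
Qed.

Lemma electrical_symmx_iso :
  exists2 phi : {linear e_m -> symmx K m}, lie_morphism phi & bijective phi.
Proof.
have [phi phiM phi_gen] := @presented_lie_universal _ _ _ _ _
  (@electrical_rel_symmx K m two_neq0).
exists phi => //; exists psi => [x|A].
  pose F := (psi \o phi : {linear _ -> _}).
  apply: (presented_lie_equivariant_id (F := F)) => [i|i y] /=.
    by rewrite phi_gen psi_gen g_ord.
  by rewrite phiM phi_gen psi_bracket g_ord.
have phig (i : 'I_m) : phi (g i) = symmx_gen K i by rewrite g_ord phi_gen.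
(* For [phi \o psi], it is enough that [phi] undoes [psi] on products; the induction is on the gap
   between the indices. *)
have phi_prod_le d (i j : 'I_m) : j = (i + d)%N :> nat ->
    phi (root_prod g i j) = symmx_prod K i j.
  elim: d i => [|[|d] IHd] i ij.
  - have -> : j = i by apply/val_inj; rewrite /= ij addn0.
    by rewrite root_prodii linearZ /= phig symmx_prodii.
  - have aij : adjacent i j by rewrite ij addn1 adjacentS.
    (* At gap 1, [bracket_root_prod_diag] yields twice the root product, so both sides are doubled
       first. *)
    apply: (scalerI two_neq0); rewrite -linearZ /=.
    have := bracket_root_prod_diag g_far i j.
    rewrite aij mulr1 => <-.
    rewrite phiM phig root_prodii linearZ /= phig -symmx_prodii.
    by rewrite bracket_symmx_prod aij !scale1r scaler_nat mulr2n.
  have lt_im : (i.+1 < m)%N by have := ltn_ord j; rewrite ij; lia.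
  rewrite -root_prod_step; last by lia.
  rewrite phiM phig (IHd (Ordinal lt_im)) /=; last by lia.
  rewrite bracket_symmx_prod adjacentS adjacent_far; last by lia.
  by rewrite scale1r scale0r addr0.
have phi_prod (i j : 'I_m) : phi (root_prod g i j) = symmx_prod K i j.
  have [le_ij|/ltnW le_ji] := leqP i j.
    by apply: (phi_prod_le (j - i)%N); rewrite subnKC.
  rewrite root_prodC symmx_prodC.
  by apply: (phi_prod_le (i - j)%N); rewrite subnKC.
rewrite [RHS]symmx_decomp // /psi linear_sum; apply: eq_bigr => i _ /=.
rewrite linear_sum; apply: eq_bigr => j _ /=.
by rewrite linearZ /= phi_prod.
Qed.

End ElectricalIso.

(** * Projection onto the semidirect product *)

Lemma sympl_form_tr (K : fieldType) n : (sympl_form K n)^T = - sympl_form K n.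
Proof.
by rewrite /sympl_form tr_block_mx opp_block_mx !linear0 linearN /= trmx1 opprK.
Qed.

Lemma sympl_form_sqr (K : fieldType) n :
  sympl_form K n *m sympl_form K n = - 1%:M.
Proof.
rewrite /sympl_form mulmx_block !mul0mx !mulmx0 !add0r !addr0 mulmxN mulNmx.
by rewrite !mulmx1 scalar_mx_block opp_block_mx !oppr0.
Qed.

Section SymplecticProjection.
Variables (K : fieldType) (n : nat).
Local Notation m := (2 * n + 1)%N.
Local Notation J := (sympl_form K n).

Fact even_ix_proof (k : 'I_n.+1) : (k.*2 < m)%N.
Proof. by have := ltn_ord k; lia. Qed.

Definition even_ix k : 'I_m := Ordinal (even_ix_proof k).

Fact odd_ix_proof (k : 'I_n) : (k.*2.+1 < m)%N.
Proof. by have := ltn_ord k; lia. Qed.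

Definition odd_ix k : 'I_m := Ordinal (odd_ix_proof k).

(* Write [v_(2k) = p_(k-1) + p_k] and [v_(2k+1) = q_k], where [p_(-1) = 0] and
   [p_n = z]: then [p_k, q_k] (for [k < n]) is a symplectic basis and [z] spans
   the radical. The [_coord] matrices give coordinates with respect to
   [p, q, z]; [symp_basis] and [rad_vec] expand [p, q, z] in the [v_i]. *)
Definition pcoord : 'M[K]_(n, m) :=
  rowsub (fun k => even_ix (widen_ord (leqnSn n) k)) 1%:M
    + rowsub (fun k => even_ix (lift ord0 k)) 1%:M.
Definition qcoord : 'M[K]_(n, m) := rowsub odd_ix 1%:M.

Definition symp_coord : 'M[K]_(n + n, m) := col_mx pcoord qcoord.
Definition rad_coord : 'rV[K]_m := row (even_ix ord_max) 1%:M.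

(** Solving [v_(2k) = p_(k-1) + p_k] gives [p_k] as the sum of [(-1)^(k-j) v_(2j)] over [j <= k];
    this is its coefficient on [v_i], and [k = n] gives [z]. *)
Definition alt_coef (k i : nat) : K :=
  if odd i || (k < i./2)%N then 0 else (-1) ^+ (k - i./2).

Definition symp_basis : 'M[K]_(m, n + n) :=
  row_mx (\matrix_(i, k) alt_coef k i) (\matrix_(i, k) (i == odd_ix k)%:R).
Definition rad_vec : 'cV[K]_m := \col_i alt_coef n i.

Lemma alt_coef_odd k i : alt_coef k i.*2.+1 = 0.
Proof. by rewrite /alt_coef /= odd_double. Qed.

Lemma alt_coef_even k i :
  alt_coef k i.*2 = if (k < i)%N then 0 else (-1) ^+ (k - i).
Proof. by rewrite /alt_coef odd_double doubleK. Qed.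

Lemma alt_coef_step k i :
  alt_coef k i.*2 + alt_coef k i.+1.*2 = (i == k)%:R.
Proof.
rewrite !alt_coef_even ltnS; have [lt_ki|lt_ik|->] := ltngtP k i.
- by rewrite addr0.
- by rewrite -(subnSK lt_ik) exprS mulN1r addNr.
- by rewrite subnn addr0.
Qed.

Lemma mul_pcoord p (X : 'M[K]_(m, p)) k c :
  (pcoord *m X) k c
    = X (even_ix (widen_ord (leqnSn n) k)) c + X (even_ix (lift ord0 k)) c.
Proof. by rewrite mulmxDl !mul_rowsub_mx !mul1mx !mxE. Qed.

Lemma mul_qcoord p (X : 'M[K]_(m, p)) k c :
  (qcoord *m X) k c = X (odd_ix k) c.
Proof. by rewrite mul_rowsub_mx mul1mx mxE. Qed.

Lemma mul_rad_coord p (X : 'M[K]_(m, p)) k c :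
  (rad_coord *m X) k c = X (even_ix ord_max) c.
Proof. by rewrite -row_mul mul1mx mxE. Qed.

Let double_neq_doubleS (a b : nat) : (a.*2 == b.*2.+1) = false.
Proof. by lia. Qed.

Lemma symp_coord_basis : symp_coord *m symp_basis = 1%:M.
Proof.
rewrite mul_col_row [RHS]scalar_mx_block.
congr block_mx; apply/matrixP=> k l; rewrite ?mul_pcoord ?mul_qcoord !mxE.
- exact: alt_coef_step.
- by rewrite -!val_eqE /= !double_neq_doubleS addr0.
- exact: alt_coef_odd.
- by rewrite -!val_eqE /= eqSS (inj_eq double_inj).
Qed.

Lemma symp_coord_rad : symp_coord *m rad_vec = 0.
Proof.
rewrite mul_col_mx -[RHS]col_mx0.
congr col_mx; apply/matrixP=> k l; rewrite ?mul_pcoord ?mul_qcoord !mxE.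
  by rewrite alt_coef_step /= ltn_eqF.
exact: alt_coef_odd.
Qed.

Lemma rad_coord_basis : rad_coord *m symp_basis = 0.
Proof.
rewrite mul_mx_row -[RHS]row_mx0.
congr row_mx; apply/matrixP=> k l; rewrite mul_rad_coord !mxE.
  by rewrite alt_coef_even ltn_ord.
by rewrite -val_eqE /= double_neq_doubleS.
Qed.

Lemma rad_coord_vec : rad_coord *m rad_vec = 1%:M.
Proof.
apply/matrixP=> k l; rewrite mul_rad_coord !mxE !ord1.
by rewrite alt_coef_even ltnn subnn.
Qed.

Lemma symp_basis_coord : symp_basis *m symp_coord + rad_vec *m rad_coord = 1%:M.
Proof.
(* A one-sided inverse of a square matrix is two-sided, but here the sizes [2 * n + 1] and
   [n + n + 1] are equal only propositionally. *)
have mulmxC1 p q (A : 'M[K]_(p, q)) (B : 'M_(q, p)) :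
    p = q -> A *m B = 1%:M -> B *m A = 1%:M.
  by move=> pq; case: q / pq A B => A B; exact: mulmx1C.
rewrite -mul_row_col; apply: mulmxC1; first by lia.
rewrite mul_col_row symp_coord_basis symp_coord_rad rad_coord_basis.
by rewrite rad_coord_vec -scalar_mx_block.
Qed.

(** Column [b] of [qcoord] is nonzero only for [b = 2k+1], and row [k] of [pcoord] is supported on
    the two neighbours [2k] and [2k+2]. *)
Lemma tr_pcoord_qcoord (a b : 'I_m) :
  (pcoord^T *m qcoord) a b = (odd b && adjacent a b)%:R.
Proof.
rewrite mxE; under eq_bigr do rewrite !mxE.
have [b_odd|b_even] /= := boolP (odd b); last first.
  rewrite big1 // => k _; rewrite -[odd_ix k == b]val_eqE /=.
  by rewrite (_ : (_ == _ :> nat) = false) ?mulr0 //; move: b_even; lia.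
have lt_bn : (b./2 < n)%N by move: b_odd (ltn_ord b); lia.
rewrite (bigD1 (Ordinal lt_bn)) //= big1 ?addr0 => [|k /eqP neq_kb].
  have b_eq : b = b./2.*2.+1 :> nat by move: b_odd; lia.
  rewrite -!val_eqE /= -b_eq eqxx mulr1 -natrD b_eq /adjacent; congr _%:R.
  by rewrite /bump; lia.
rewrite -[odd_ix k == b]val_eqE /= (_ : (_ == _ :> nat) = false) ?mulr0 //.
by apply/eqP=> b_eq; apply: neq_kb; apply/val_inj; rewrite /= -b_eq; lia.
Qed.

(** With [X = pcoord^T *m qcoord] the right side is [X - X^T]; even rows see [X] and odd rows
    [- X^T], which gives the sign. *)
Lemma chain_formE : chain_form K m = symp_coord^T *m J *m symp_coord.
Proof.
rewrite tr_col_mx mul_row_block mul_row_col !mulmx0 mulmx1 mulmxN mulmx1.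
rewrite add0r addr0 mulNmx.
rewrite (_ : qcoord^T *m pcoord = (pcoord^T *m qcoord)^T); last first.
  by rewrite trmx_mul trmxK.
have := tr_pcoord_qcoord; move: (pcoord^T *m qcoord) => X XE.
apply/matrixP=> a b; rewrite !mxE !XE (adjacentC b a) -signr_odd.
have [ab|_] := boolP (adjacent a b); last by rewrite !andbF mulr0 oppr0 addr0.
have -> : odd b = ~~ odd a by move: ab; rewrite /adjacent; lia.
by rewrite !andbT mulr1; case: (odd a); rewrite ?expr1 ?addr0 ?oppr0 ?add0r.
Qed.

Lemma chain_form_rad : chain_form K m *m rad_vec = 0.
Proof. by rewrite chain_formE -mulmxA symp_coord_rad mulmx0. Qed.

(** The usual identification of [Sym^2 V] with the symplectic algebra, [S |-> S J], applied to the
    [Sym^2 V] component of [A]. *)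
Fact symp_part_proof (A : symmx K m) :
  symp_coord *m A *m symp_coord^T *m J \in @is_sp K n.
Proof.
rewrite inE !trmx_mul trmxK symmx_tr sympl_form_tr !mulmxA.
by rewrite !mulNmx addNr.
Qed.

Definition symp_part A : sp K n := Sp (symp_part_proof A).

Definition symp_proj (A : symmx K m) : semidirect (sp_std K n) :=
  (symp_part A, symp_coord *m A *m rad_coord^T).

Lemma symp_proj_linear : linear symp_proj.
Proof.
move=> a A B; congr pair; first apply/val_inj; rewrite /= mulmxDr !mulmxDl.
  by rewrite -!scalemxAr -!scalemxAl.
by rewrite -!scalemxAr -!scalemxAl.
Qed.

HB.instance Definition _ :=
  GRing.isLinear.Build K (symmx K m) (semidirect (sp_std K n)) *:%R symp_proj
    symp_proj_linear.

(** By [chain_formE] every product through [chain_form] passes through [J] on [V]. *)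
Lemma symp_proj_bracket A B :
  symp_proj (bracket A B) = bracket (symp_proj A) (symp_proj B).
Proof.
congr pair; first apply/val_inj; rewrite /= mulmxBr !mulmxBl chain_formE.
  by rewrite !mulmxA.
by rewrite /std_act /= !mulmxA.
Qed.

Lemma symp_proj_surj y : exists A, symp_proj A = y.
Proof.
case: y => [[Q Qsp] u].
(* Since [J^2 = -1], this inverts [S |-> S J]. *)
pose W := - (Q *m J).
have Wsym : W^T = W.
  move: Qsp; rewrite inE addr_eq0 => /eqP QJ.
  rewrite /W linearN /= trmx_mul sympl_form_tr mulNmx opprK.
  rewrite -[LHS]mulmx1 -[1%:M]opprK -sympl_form_sqr mulmxN mulmxA.
  by rewrite -(mulmxA J) QJ mulmxN !mulmxA sympl_form_sqr !mulNmx mul1mx !opprK.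
(* [U + U^T] is the symmetric tensor lifting [u] to [V z]. *)
pose U := symp_basis *m u *m rad_vec^T.
pose B := symp_basis *m W *m symp_basis^T + (U + U^T).
have Bsym : B \in @is_symmx K m.
  rewrite inE /B !linearD /= [U^T^T]trmxK [U^T + U]addrC.
  by rewrite (trmx_mul _ symp_basis^T) trmxK trmx_mul Wsym mulmxA.
have TB : symp_coord *m B = W *m symp_basis^T + u *m rad_vec^T.
  rewrite /B /U !trmx_mul trmxK !mulmxDr !mulmxA symp_coord_basis.
  by rewrite symp_coord_rad !mul0mx !mul1mx addr0.
exists (Symmx Bsym); congr pair; first apply/val_inj; rewrite /= TB mulmxDl.
  rewrite -!(mulmxA _ _ symp_coord^T) -!trmx_mul symp_coord_basis.
  rewrite symp_coord_rad trmx0 trmx1 mulmx0 addr0 mulmx1 mulNmx -mulmxA.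
  by rewrite sympl_form_sqr mulmxN mulmx1 opprK.
rewrite -!mulmxA -!trmx_mul rad_coord_basis rad_coord_vec.
by rewrite trmx0 trmx1 mulmx0 add0r mulmx1.
Qed.

Lemma symp_proj_eq0 A :
  symp_proj A = 0 <-> exists c, (A : 'M_m) = c *: (rad_vec *m rad_vec^T).
Proof.
split=> [[TAJ TA]|[c AE]]; last first.
  congr pair; first apply/val_inj; rewrite /= AE -scalemxAr mulmxA.
    by rewrite symp_coord_rad !mul0mx scaler0 !mul0mx.
  by rewrite symp_coord_rad !mul0mx scaler0 mul0mx.
have {}TAJ : symp_coord *m A *m symp_coord^T = 0.
  rewrite -[LHS]mulmx1 -[1%:M]opprK -sympl_form_sqr mulmxN mulmxA TAJ.
  by rewrite mul0mx oppr0.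
have tA : rad_coord *m A *m symp_coord^T = 0.
  apply: (can_inj (@trmxK _ _ _)).
  by rewrite !trmx_mul trmxK symmx_tr mulmxA TA trmx0.
exists ((rad_coord *m A *m rad_coord^T) 0 0).
(* Splitting along [V + <z>] cuts [A] into four blocks, of which only the one on [z^2] survives. *)
have AE : (A : 'M_m) = (symp_basis *m symp_coord + rad_vec *m rad_coord) *m A
    *m (symp_basis *m symp_coord + rad_vec *m rad_coord)^T.
  by rewrite symp_basis_coord trmx1 mul1mx mulmx1.
rewrite [LHS]AE linearD /= !trmx_mul mulmxDl !mulmxDr.
rewrite -!(mulmxA symp_basis) -!(mulmxA rad_vec) !mulmxDl.
rewrite -!(mulmxA symp_basis) -!(mulmxA rad_vec) !(mulmxA _ _ symp_basis^T).
rewrite !(mulmxA _ _ rad_vec^T).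
rewrite TAJ TA tA !mulmx0 !mul0mx !add0r.
by rewrite {1}[rad_coord *m _ *m _]mx11_scalar mul_mx_scalar -scalemxAl.
Qed.

End SymplecticProjection.

(** * The central line and the exact sequence *)

Section ScaleLine.
Variables (K : fieldType) (L : lieAlgType K) (z : L).

Definition scale_line (c : abelian_lie K^o) : L := (c : K) *: z.

Fact scale_line_linear : linear scale_line.
Proof. by move=> a b c; rewrite /scale_line scalerDl scalerA. Qed.

HB.instance Definition _ :=
  GRing.isLinear.Build K (abelian_lie K^o) L *:%R scale_line scale_line_linear.

End ScaleLine.

Lemma electricalA_odd_extension (K : fieldType) (n : nat) :
    2 != 0 :> K ->
  exists (iota : {linear abelian_lie K^o -> electricalA K (2 * n + 1)})
         (pi   : {linear electricalA K (2 * n + 1) -> semidirect (sp_std K n)}),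
    [/\ lie_morphism iota, lie_morphism pi, short_exact iota pi
      & forall c, central (iota c)].
Proof.
move=> two_neq0.
have [phi phiM phi_bij] := electrical_symmx_iso (2 * n + 1) two_neq0.
have [psi phiK psiK] := phi_bij.
have rad_sym : rad_vec K n *m (rad_vec K n)^T \in @is_symmx K (2 * n + 1).
  by rewrite inE trmx_mul trmxK.
(* The preimage of the tensor [z^2], central because [rad_vec] lies in the radical of the form. *)
pose z := psi (Symmx rad_sym).
have rad_chain_form : (rad_vec K n)^T *m chain_form K (2 * n + 1) = 0.
  apply: (can_inj (@trmxK _ _ _)); rewrite trmx_mul trmxK chain_form_tr.
  by rewrite mulNmx chain_form_rad trmx0 oppr0.
have z_central x : bracket x z = 0.
  apply: (bij_inj phi_bij); rewrite phiM psiK linear0; apply/val_inj => /=.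
  rewrite mulmxA -(mulmxA _ _ (rad_vec K n)) chain_form_rad mulmx0 mul0mx.
  by rewrite -(mulmxA (rad_vec K n)) rad_chain_form mulmx0 mul0mx subrr.
(* Applying [rad_coord] on both sides of [z^2 = 0] would give [1 = 0]. *)
have z_neq0 : z != 0.
  apply: contraNneq (oner_neq0 K) => z0.
  have /(congr1 val) /= : phi z = 0 by rewrite z0 linear0.
  rewrite psiK /= => /(congr1 (mulmx (rad_coord K n))).
  rewrite mulmxA rad_coord_vec mul1mx mulmx0 => /(congr1 trmx).
  rewrite trmxK trmx0 => /(congr1 (mulmx (rad_coord K n))).
  rewrite rad_coord_vec mulmx0 => /matrixP/(_ 0 0).
  by rewrite !mxE eqxx => /eqP.
exists (scale_line z : {linear _ -> _}).
exists (@symp_proj K n \o phi : {linear _ -> _}).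
split=> [c d|x y||c x] /=.
- by rewrite /scale_line bracketZr bracketC z_central oppr0 !scaler0 scale0r.
- by rewrite phiM symp_proj_bracket.
- split=> [c d /eqP|x|y] /=.
  + rewrite -subr_eq0 -scalerBl scaler_eq0 (negPf z_neq0) orbF subr_eq0.
    by move/eqP.
  + split=> [/symp_proj_eq0[c phixE]|[c ->]].
      exists c; apply: (bij_inj phi_bij); rewrite linearZ psiK /=.
      exact/val_inj.
    rewrite /scale_line linearZ psiK.
    by apply/symp_proj_eq0; exists c.
  + by have [A <-] := symp_proj_surj y; exists (psi A); rewrite psiK.
- by rewrite /scale_line bracketZr z_central scaler0.
Qed.

Theorem theorem2p7 (R : realType) (n : nat) (n_ge1 : (1 <= n)%N) :
  exists (iota : {linear abelian_lie (R[i])^o -> electricalA R[i] (2 * n + 1)})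
         (pi   : {linear electricalA R[i] (2 * n + 1) ->
                 semidirect (sp_std R[i] n)}),
    [/\ lie_morphism iota, lie_morphism pi, short_exact iota pi
      & forall c, central (iota c)].
Proof. by apply: electricalA_odd_extension; rewrite Num.Theory.pnatr_eq0. Qed.
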